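(* Let $X=\{x_1,\ldots,x_n\}$. There is a deterministic learning algorithm which, for every non-constant Boolean function $f$ of the variables $X$ that is read-once over the basis $\{\land,\lor\}$, identifies $f$ exactly using only subcube identity queries, and it performs $O(n^2)$ such queries in the worst case.
   Context: A formula over a set $\mathcal B$ of Boolean functions (a basis) is read-once if every variable occurring in it occurs exactly once; a Boolean function of the variables $X$ is read-once over $\mathcal B$ if it can be expressed by a read-once formula over $\mathcal B$ (variables of $X$ not occurring in the formula are fictitious for the function). A partial assignment $p$ to $X$ is a map $X\to\{0,1,*\}$; it is total if it takes no variable to $*$. The projection $f_p$ is the function of the variables $p^{-1}( * )$ obtained from $f$ by fixing each $x_i\notin p^{-1}( * )$ to $p(x_i)$. A subcube identity query takes a partial assignment $p$ and answers ''yes'' if $f_p\equiv 0$ or $f_p\equiv 1$, and ''no'' otherwise (no further information). Exact identification: the set $X$ and the basis are known in advance; an algorithm adaptively asks queries about the unknown target function $f$ (from the given class) and must determine $f$ exactly; its complexity is the worst-case number of queries over all targets in the class. *)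

(* Defs.v *)
From mathcomp Require Import all_boot.

Set Implicit Arguments.
Unset Strict Implicit.
Unset Printing Implicit Defensive.

(* Boolean functions of the variables [V]; being finite functions, they are
   equal as soon as they agree pointwise. *)
Definition boolfun (V : finType) := {ffun {ffun V -> bool} -> bool}.

Definition constant_fun (V : finType) (f : boolfun V) : bool :=
  [exists b : bool, [forall x, f x == b]].

(* [None] plays the role of the star. *)
Definition passign (V : finType) := {ffun V -> option bool}.

Definition free_var (V : finType) (p : passign V) : finType :=
  {v : V | p v == None}.

(* [insub v] is [Some] exactly when [p v] is a star, so the default of [odflt]
   is never used. *)
Definition extend (V : finType) (p : passign V)
    (y : {ffun free_var p -> bool}) : {ffun V -> bool} :=
  [ffun v => if insub v is Some w then y w else odflt false (p v)].

Definition projection (V : finType) (f : boolfun V) (p : passign V) :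
    boolfun (free_var p) :=
  [ffun y => f (extend y)].

Definition subcube_identity (V : finType) (f : boolfun V) (p : passign V) :
    bool :=
  constant_fun (projection f p).

Inductive formula (V : Type) : Type :=
  | FVar of V
  | FAnd of formula V & formula V
  | FOr of formula V & formula V.

Fixpoint feval (V : finType) (phi : formula V) (x : {ffun V -> bool}) : bool :=
  match phi with
  | FVar v => x v
  | FAnd a b => feval a x && feval b x
  | FOr a b => feval a x || feval b x
  end.

(* Listed with multiplicity. *)
Fixpoint fvars (V : Type) (phi : formula V) : seq V :=
  match phi with
  | FVar v => [:: v]
  | FAnd a b | FOr a b => fvars a ++ fvars b
  end.

Definition read_once (V : finType) (f : boolfun V) : Prop :=
  exists2 phi : formula V, uniq (fvars phi) & forall x, f x = feval phi x.

(* A deterministic adaptive query algorithm, as a decision tree: it either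
   halts with a hypothesis, or asks one query and continues according to the
   yes/no answer. *)
Inductive learner (V : finType) : Type :=
  | Output of boolfun V
  | Query of passign V & (bool -> learner V).

Fixpoint result (V : finType) (A : learner V) (oracle : passign V -> bool) :
    boolfun V :=
  match A with
  | Output g => g
  | Query p k => result (k (oracle p)) oracle
  end.

Fixpoint nb_queries (V : finType) (A : learner V)
    (oracle : passign V -> bool) : nat :=
  match A with
  | Output _ => 0
  | Query p k => (nb_queries (k (oracle p)) oracle).+1
  end.

(* Main.v *)
Require Import Defs.
From mathcomp Require Import all_boot.

Set Implicit Arguments.
Unset Strict Implicit.
Unset Printing Implicit Defensive.

(* As f is monotone with f(0) = 0 and f(1) = 1, fixing the variables of a set S
   to 1 makes f constant exactly when f(S) = 1, so subcube identity queries
   simulate membership queries.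

   If P is false and x |: P is true, greedy deletion from x |: P and greedy
   addition to P give, in n queries each, a minimal true point S containing x
   and a maximal false point Q avoiding x.  Then S minus y for y in S, and Q for
   y outside Q, play the role of P for the variables y.  Iterating this reaches
   every relevant variable: the points found for a conjunction meet both
   conjuncts, and those found for a disjunction miss variables of both disjuncts.

   Once a maximal false point Q_x avoiding x is known for every relevant x, the
   lowest common ancestor of x and y in the formula is a conjunction if and only
   if f is true at (x |: Q_x) :&: (y |: Q_y): one query per pair.  These answers
   form a graph whose maximal cliques are the minimal true points of f. *)

(** * Monotone formulas as predicates on sets of variables *)

Section Formulas.

Variable V : finType.
Implicit Types (phi a b : formula V) (S Q K : {set V}) (x y v : V).

Fixpoint sat phi S : bool :=
  match phi with
  | FVar v => v \in S
  | FAnd a b => sat a S && sat b S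
  | FOr a b => sat a S || sat b S
  end.

Lemma feval_sat phi (z : {ffun V -> bool}) :
  feval phi z = sat phi [set v | z v].
Proof. by elim: phi => [v|a IHa b IHb|a IHa b IHb] /=; rewrite ?inE ?IHa ?IHb. Qed.

Lemma sat_mono phi S Q :
  {in fvars phi, forall v, v \in S -> v \in Q} -> sat phi S -> sat phi Q.
Proof.
elim: phi => [v|a IHa b IHb|a IHa b IHb] /= sSQ.
- by apply: sSQ; rewrite inE.
- case/andP=> aS bS; rewrite IHa ?IHb // => v vin; apply: sSQ;
  by rewrite mem_cat vin ?orbT.
- case/orP=> cS; [rewrite IHa // | rewrite IHb ?orbT //] => v vin; apply: sSQ;
  by rewrite mem_cat vin ?orbT.
Qed.

Lemma sat_sub phi S Q : S \subset Q -> sat phi S -> sat phi Q.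
Proof. by move/subsetP=> sSQ; apply: sat_mono => v _; apply: sSQ. Qed.

Lemma sat_local phi S Q :
  {in fvars phi, forall v, (v \in S) = (v \in Q)} -> sat phi S = sat phi Q.
Proof. by move=> eSQ; apply/idP/idP; apply: sat_mono => v /eSQ->. Qed.

Lemma sat_full phi S : {subset fvars phi <= S} -> sat phi S.
Proof.
elim: phi => [v|a IHa b IHb|a IHa b IHb] /= sS.
- by apply: sS; rewrite inE.
- by rewrite IHa ?IHb // => v vin; apply: sS; rewrite mem_cat vin ?orbT.
- by rewrite IHa // => v vin; apply: sS; rewrite mem_cat vin.
Qed.

Lemma sat_meets phi S : sat phi S -> exists2 v, v \in fvars phi & v \in S.
Proof.
elim: phi => [v|a IHa b IHb|a IHa b IHb] /=.
- by exists v; rewrite ?inE.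
- by case/andP=> /IHa[v av vS] _; exists v; rewrite // mem_cat av.
- by case/orP=> [/IHa|/IHb] [v av vS]; exists v; rewrite // mem_cat av ?orbT.
Qed.

Lemma unsat_misses phi Q : ~~ sat phi Q -> exists2 v, v \in fvars phi & v \notin Q.
Proof.
move=> nQ; case: (altP (@allP _ (mem Q) (fvars phi))) => [/sat_full|].
  by rewrite (negbTE nQ).
by rewrite -has_predC => /hasP.
Qed.

Lemma critical_var phi v S : ~~ sat phi S -> sat phi (v |: S) -> v \in fvars phi.
Proof.
move=> nS; apply: contraLR => nv; rewrite (_ : sat _ _ = sat phi S) //.
by apply: sat_local => u uphi; rewrite !inE; case: eqP uphi nv => // -> ->.
Qed.

Lemma sat_add phi v S : v \notin fvars phi -> sat phi (v |: S) = sat phi S.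
Proof.
by move=> nv; apply: sat_local => u uphi; rewrite !inE; case: eqP uphi nv => // -> ->.
Qed.

Lemma sat_rem phi v S : v \notin fvars phi -> sat phi (S :\ v) = sat phi S.
Proof.
by move=> nv; apply: sat_local => u uphi; rewrite !inE; case: eqP uphi nv => // -> ->.
Qed.

(** * Minimal true points and maximal false points *)

(* On a read-once formula these are the minimal true points and the maximal
   false points, up to the variables that do not occur in the formula. *)
Definition mintrue phi S :=
  sat phi S /\ {in fvars phi, forall v, v \in S -> ~~ sat phi (S :\ v)}.

Definition maxfalse phi Q :=
  ~~ sat phi Q /\ {in fvars phi, forall v, v \notin Q -> sat phi (v |: Q)}.

Lemma uniq_catP a b : uniq (fvars a ++ fvars b) ->
  [/\ uniq (fvars a), uniq (fvars b),
      {in fvars a, forall v, v \notin fvars b} &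
      {in fvars b, forall v, v \notin fvars a}].
Proof.
rewrite cat_uniq => /and3P[-> /hasPn dab ->]; split=> // v av.
by apply/negP=> /dab; rewrite av.
Qed.

Lemma maxfalse_andC a b Q : maxfalse (FAnd a b) Q -> maxfalse (FAnd b a) Q.
Proof.
case=> nQ mQ; split; first by rewrite /= andbC.
by move=> v vab /=; rewrite andbC; apply: mQ; move: vab; rewrite /= !mem_cat orbC.
Qed.

(** Adding [x] makes the conjunction true without touching [b], so [b] already holds at [Q] and [a]
    fails there. A variable of [b] outside [Q] could not repair [a], hence there is none. *)
Lemma maxfalse_and a b Q x : uniq (fvars a ++ fvars b) ->
  maxfalse (FAnd a b) Q -> x \in fvars a -> x \notin Q ->
  maxfalse a Q /\ {subset fvars b <= Q}.
Proof.
move=> /uniq_catP[_ _ dab dba] [/= nQ mQ] ax xQ.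
have bQ: sat b Q.
  have := mQ x; rewrite mem_cat ax => /(_ isT xQ).
  by rewrite (sat_add _ (dab _ ax)) => /andP[].
have naQ: ~~ sat a Q by move: nQ; rewrite bQ andbT.
split; first split=> // v av vQ.
  by have := mQ v; rewrite mem_cat av => /(_ isT vQ) /andP[].
move=> v bv; apply/negPn/negP => vQ.
have := mQ v; rewrite mem_cat bv orbT => /(_ isT vQ).
by rewrite (sat_add _ (dba _ bv)) (negbTE naQ).
Qed.

Lemma maxfalse_or a b Q : uniq (fvars a ++ fvars b) ->
  maxfalse (FOr a b) Q -> maxfalse a Q /\ maxfalse b Q.
Proof.
move=> /uniq_catP[_ _ dab dba] [/= /norP[naQ nbQ] mQ].
split; split=> // v vin vQ; have := mQ v; rewrite mem_cat vin ?orbT => /(_ isT vQ).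
  by rewrite (sat_add _ (dab _ vin)) (negbTE nbQ) orbF.
by rewrite (sat_add _ (dba _ vin)) (negbTE naQ).
Qed.

Lemma mintrue_and a b S : uniq (fvars a ++ fvars b) ->
  mintrue (FAnd a b) S -> mintrue a S /\ mintrue b S.
Proof.
move=> /uniq_catP[_ _ dab dba] [/= /andP[aS bS] mS].
split; split=> // v vin vS; have := mS v; rewrite mem_cat vin ?orbT => /(_ isT vS).
  by rewrite (sat_rem _ (dab _ vin)) bS andbT.
by rewrite (sat_rem _ (dba _ vin)) aS.
Qed.

(** Deleting [x] makes the disjunction false without touching [b], so [b] is already false at [S]
    and [a] alone makes it true. *)
Lemma mintrue_orl a b S x : uniq (fvars a ++ fvars b) ->
  mintrue (FOr a b) S -> x \in fvars a -> x \in S -> mintrue a S.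
Proof.
move=> /uniq_catP[_ _ dab dba] [/= tS mS] ax xS.
have nbS: ~~ sat b S.
  have := mS x; rewrite mem_cat ax => /(_ isT xS).
  by rewrite (sat_rem _ (dab _ ax)) => /norP[].
split; first by move: tS; rewrite (negbTE nbS) orbF.
move=> v av vS; have := mS v; rewrite mem_cat av => /(_ isT vS).
by case/norP.
Qed.

Lemma mintrue_orC a b S : mintrue (FOr a b) S -> mintrue (FOr b a) S.
Proof.
case=> tS mS; split; first by rewrite /= orbC.
by move=> v vab /=; rewrite orbC; apply: mS; move: vab; rewrite /= !mem_cat orbC.
Qed.

(** [U] stands for the variables found so far. Points are compared with [U] on the variables of
    [phi] only, so that the same [S] and [Q] serve the subformulas of [phi]. *)
Definition explored phi (U : {set V}) x :=
  (exists2 S, mintrue phi S & x \in S /\ {in fvars phi, forall v, v \in S -> v \in U})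
  /\ (exists2 Q, maxfalse phi Q & x \notin Q /\ {in fvars phi, forall v, v \notin Q -> v \in U}).

(** This is what makes the exploration complete. By induction on [phi]: the true point of a single
    explored variable reaches both operands of a conjunction, its false point reaches both operands
    of a disjunction, and [explored] restricts to each operand. *)
Lemma explored_all phi (U : {set V}) : uniq (fvars phi) ->
  (exists2 x, x \in fvars phi & x \in U) ->
  {in fvars phi, forall x, x \in U -> explored phi U x} ->
  {subset fvars phi <= U}.
Proof.
elim: phi => [v|a IHa b IHb|a IHa b IHb] Uab [x0 x0ab x0U] expl.
- by move=> v'; move: x0ab; rewrite !inE => /eqP<- /eqP->.
- have [Ua Ub dab dba] := uniq_catP Uab.
  have [[S /(mintrue_and Uab)[mSa mSb] [_ sSU]] _] := expl _ x0ab x0U.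
  have/IHa sa: exists2 x, x \in fvars a & x \in U.
    have [x ax xS] := sat_meets (proj1 mSa).
    by exists x => //; apply: sSU; rewrite //= mem_cat ax.
  have/IHb sb: exists2 x, x \in fvars b & x \in U.
    have [x bx xS] := sat_meets (proj1 mSb).
    by exists x => //; apply: sSU; rewrite //= mem_cat bx orbT.
  move=> y; rewrite /= mem_cat => /orP[]; [apply: sa|apply: sb] => // x ax xU.
    have xab: x \in fvars (FAnd a b) by rewrite /= mem_cat ax.
    have [[S1 /(mintrue_and Uab)[mS1 _] [xS1 s1]] [Q1 mQ1 [xQ1 q1]]] := expl _ xab xU.
    have [mQ1a _] := maxfalse_and Uab mQ1 ax xQ1.
    split; [exists S1 | exists Q1] => //; split=> // v av; [apply: s1|apply: q1];
    by rewrite /= mem_cat av.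
  have xab: x \in fvars (FAnd a b) by rewrite /= mem_cat ax orbT.
  have [[S1 /(mintrue_and Uab)[_ mS1] [xS1 s1]] [Q1 mQ1 [xQ1 q1]]] := expl _ xab xU.
  move: (Uab); rewrite /= uniq_catC => Uba.
  have [mQ1a _] := maxfalse_and Uba (maxfalse_andC mQ1) ax xQ1.
  split; [exists S1 | exists Q1] => //; split=> // v av; [apply: s1|apply: q1];
  by rewrite /= mem_cat av orbT.
- have [Ua Ub dab dba] := uniq_catP Uab.
  have [_ [Q /(maxfalse_or Uab)[mQa mQb] [_ sQU]]] := expl _ x0ab x0U.
  have/IHa sa: exists2 x, x \in fvars a & x \in U.
    have [x ax xS] := unsat_misses (proj1 mQa).
    by exists x => //; apply: sQU; rewrite //= mem_cat ax.
  have/IHb sb: exists2 x, x \in fvars b & x \in U.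
    have [x bx xS] := unsat_misses (proj1 mQb).
    by exists x => //; apply: sQU; rewrite //= mem_cat bx orbT.
  move=> y; rewrite /= mem_cat => /orP[]; [apply: sa|apply: sb] => // x ax xU.
    have xab: x \in fvars (FOr a b) by rewrite /= mem_cat ax.
    have [[S1 mS1 [xS1 s1]] [Q1 /(maxfalse_or Uab)[mQ1 _] [xQ1 q1]]] := expl _ xab xU.
    have mS1a := mintrue_orl Uab mS1 ax xS1.
    split; [exists S1 | exists Q1] => //; split=> // v av; [apply: s1|apply: q1];
    by rewrite /= mem_cat av.
  have xab: x \in fvars (FOr a b) by rewrite /= mem_cat ax orbT.
  have [[S1 mS1 [xS1 s1]] [Q1 /(maxfalse_or Uab)[_ mQ1] [xQ1 q1]]] := expl _ xab xU.
  move: (Uab); rewrite /= uniq_catC => Uba.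
  have mS1a := mintrue_orl Uba (mintrue_orC mS1) ax xS1.
  split; [exists S1 | exists Q1] => //; split=> // v av; [apply: s1|apply: q1];
  by rewrite /= mem_cat av orbT.
Qed.

(** * The graph of conjunctions and its maximal cliques *)

(* The lowest node of [phi] above both leaves [x] and [y] is a conjunction. *)
Fixpoint adj phi x y : bool :=
  match phi with
  | FVar _ => false
  | FAnd a b => [|| adj a x y, adj b x y,
                    (x \in fvars a) && (y \in fvars b) |
                    (x \in fvars b) && (y \in fvars a)]
  | FOr a b => adj a x y || adj b x y
  end.

Lemma adj_vars phi x y : adj phi x y -> x \in fvars phi /\ y \in fvars phi.
Proof.
elim: phi => [v|a IHa b IHb|a IHa b IHb] //=; rewrite !mem_cat.
  by case/or4P=> [/IHa[-> ->]|/IHb[-> ->]|/andP[-> ->]|/andP[-> ->]]; rewrite ?orbT.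
by case/orP=> [/IHa[-> ->]|/IHb[-> ->]]; rewrite ?orbT.
Qed.

Lemma adjNl phi x y : x \notin fvars phi -> adj phi x y = false.
Proof. by move=> nx; apply/negP=> /adj_vars[]; rewrite (negbTE nx). Qed.

Lemma adjNr phi x y : y \notin fvars phi -> adj phi x y = false.
Proof. by move=> ny; apply/negP=> /adj_vars[_]; rewrite (negbTE ny). Qed.

(** Induction on [phi]. If [x] and [y] lie in the same operand, the other one is full at the tested
    point under a conjunction and false under a disjunction, so the test reduces to the common
    operand. The separated cases are settled directly by [mixed] and [unsat_meet]. *)
Lemma adj_test phi x y Q R : uniq (fvars phi) ->
    x \in fvars phi -> y \in fvars phi -> x != y ->
    maxfalse phi Q -> x \notin Q -> maxfalse phi R -> y \notin R ->
  adj phi x y = sat phi ((x |: Q) :&: (y |: R)).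
Proof.
elim: phi x y Q R => [v|a IHa b IHb|a IHa b IHb] x y Q R Uab.
- by rewrite !inE => /eqP-> /eqP->; rewrite eqxx.
- have [Ua Ub dab dba] := uniq_catP Uab.
  move: (Uab); rewrite /= uniq_catC => Uba.
  (* [Q1] contains all of [b] and [R1] all of [a], so the intersection looks like [u |: Q1] to [a]
     and like [v |: R1] to [b]. *)
  have mixed u v Q1 R1 : u \in fvars a -> v \in fvars b -> maxfalse (FAnd a b) Q1 ->
      u \notin Q1 -> maxfalse (FAnd a b) R1 -> v \notin R1 ->
      sat a ((u |: Q1) :&: (v |: R1)) && sat b ((u |: Q1) :&: (v |: R1)).
    move=> au bv mQ uQ /maxfalse_andC mR vR.
    have [[_ mQa] sbQ] := maxfalse_and Uab mQ au uQ.
    have [[_ mRb] saR] := maxfalse_and Uba mR bv vR.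
    apply/andP; split.
      apply: sat_mono (mQa u au uQ) => w aw wQ; rewrite !inE in wQ *.
      by rewrite wQ saR ?orbT.
    apply: sat_mono (mRb v bv vR) => w bw wR; rewrite !inE in wR *.
    by rewrite wR sbQ ?orbT.
  rewrite /= !mem_cat => /orP[xa|xb] /orP[ya|yb] nxy mQ xQ mR yR.
  + have [mQa sbQ] := maxfalse_and Uab mQ xa xQ.
    have [mRa sbR] := maxfalse_and Uab mR ya yR.
    rewrite (adjNl _ (dab _ xa)) (negbTE (dab _ xa)) (negbTE (dab _ ya)) !(andbF, orbF).
    rewrite (IHa _ _ Q R) // [sat b _]sat_full ?andbT // => w bw.
    by rewrite !inE sbQ ?sbR ?orbT.
  + by rewrite mixed // xa yb !orbT.
  + by rewrite xb ya !orbT setIC mixed.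
  + have [mQb saQ] := maxfalse_and Uba (maxfalse_andC mQ) xb xQ.
    have [mRb saR] := maxfalse_and Uba (maxfalse_andC mR) yb yR.
    rewrite (adjNl _ (dba _ xb)) (negbTE (dba _ xb)) (negbTE (dba _ yb)) !(andbF, orbF).
    rewrite (IHb _ _ Q R) // [sat a _]sat_full // => w bw.
    by rewrite !inE saQ ?saR ?orbT.
- have [Ua Ub dab dba] := uniq_catP Uab.
  (* The intersection lies below [u |: Q1], which [c] cannot tell from the false point [Q1]. *)
  have unsat_meet c u Q1 R1 : ~~ sat c Q1 -> u \notin fvars c ->
      sat c ((u |: Q1) :&: R1) = false.
    move=> nQ nu; apply: contraNF nQ; rewrite -(sat_add Q1 nu).
    by apply: sat_sub; apply: subsetIl.
  rewrite /= !mem_cat => /orP[xa|xb] /orP[ya|yb] nxy mQ xQ mR yR;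
    have [mQa mQb] := maxfalse_or Uab mQ; have [mRa mRb] := maxfalse_or Uab mR.
  + rewrite (adjNl _ (dab _ xa)) (IHa _ _ Q R) // [sat b _]unsat_meet //.
      by case: mQb.
    exact: dab.
  + rewrite (adjNr _ (dba _ yb)) (adjNl _ (dab _ xa)) [sat b _]unsat_meet ?dab //.
      by rewrite setIC unsat_meet ?dba //; case: mRa.
    by case: mQb.
  + rewrite (adjNl _ (dba _ xb)) (adjNr _ (dab _ ya)) [sat a _]unsat_meet ?dba //.
      by rewrite setIC unsat_meet ?dab //; case: mRb.
    by case: mQa.
  + rewrite (adjNl _ (dba _ xb)) (IHb _ _ Q R) // [sat a _]unsat_meet //.
      by case: mQa.
    exact: dba.
Qed.

(* [K] is a maximal clique, on the vertex set [U], of the graph [E]. *)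
Definition max_clique (U : pred V) (E : rel V) K :=
  [&& [forall x in K, U x], [forall x in K, forall y in K, (x != y) ==> E x y]
    & [forall x, U x && (x \notin K) ==> [exists y in K, ~~ E x y]]].

Lemma max_cliqueP (U : pred V) (E : rel V) K :
  reflect [/\ {in K, forall x, U x},
              {in K &, forall x y, x != y -> E x y}
            & forall x, U x -> x \notin K -> exists2 y, y \in K & ~~ E x y]
          (max_clique U E K).
Proof.
apply: (iffP and3P) => [] [h1 h2 h3]; split.
- exact/forall_inP.
- by move=> x y xK yK; move/forall_inP/(_ x xK)/forall_inP/(_ y yK)/implyP: h2.
- by move=> x Ux xK; move/forallP/(_ x)/implyP: h3; rewrite Ux xK => /(_ isT)/exists_inP.
- exact/forall_inP.
- by apply/forall_inP=> x xK; apply/forall_inP=> y yK; apply/implyP; apply: h2.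
- by apply/forallP=> x; apply/implyP=> /andP[Ux xK]; apply/exists_inP; apply: h3.
Qed.

(** A formula has no constants, so some variable occurs in it, and nothing in an empty clique would
    prevent adding that variable. *)
Lemma max_clique_neq0 phi K :
  max_clique (mem (fvars phi)) (adj phi) K -> exists x, x \in K.
Proof.
case/max_cliqueP=> _ _ mK.
have [v vphi _]: exists2 v, v \in fvars phi & v \in setT.
  by apply: sat_meets; apply: sat_full => v _; rewrite inE.
have [vK|/mK[//|y yK _]] := boolP (v \in K); first by exists v.
by exists y.
Qed.

(** A conjunction yields the join of the two graphs, whose maximal cliques are unions of one from
    each side. A disjunction yields their disjoint union, whose maximal cliques are those of either
    side. *)
Lemma sat_max_clique phi S : uniq (fvars phi) ->
  sat phi S <-> exists2 K : {set V}, K \subset S & max_clique (mem (fvars phi)) (adj phi) K.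
Proof.
elim: phi => [v|a IHa b IHb|a IHa b IHb] Uab.
- split=> /= [vS | [K /subsetP KS mK]].
    exists [set v]; rewrite ?sub1set //; apply/max_cliqueP; split=> [x|x y|x].
    + by rewrite !inE.
    + by rewrite !inE => /eqP-> /eqP->; rewrite eqxx.
    + by rewrite !inE => ->.
  have [x xK] := @max_clique_neq0 (FVar v) K mK; case/max_cliqueP: mK => Kv _ _.
  by have := Kv x xK; rewrite !inE => /eqP<-; apply: KS.
- have [/IHa{}IHa /IHb{}IHb dab dba] := uniq_catP Uab.
  split=> /= [/andP[/IHa[Ka KaS mKa] /IHb[Kb KbS mKb]] | [K KS mK]].
    exists (Ka :|: Kb); first by rewrite subUset KaS.
    case/max_cliqueP: mKa => sKa cKa mKa; case/max_cliqueP: mKb => sKb cKb mKb.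
    apply/max_cliqueP; split=> [x|x y|x] /=.
    + by rewrite !inE mem_cat => /orP[/sKa|/sKb] /= ->; rewrite ?orbT.
    + rewrite !inE => /orP[] xK /orP[] yK nxy.
      * by rewrite cKa.
      * by rewrite (sKa _ xK : _ \in _) (sKb _ yK : _ \in _) !orbT.
      * by rewrite (sKb _ xK : _ \in _) (sKa _ yK : _ \in _) !orbT.
      * by rewrite cKb ?orbT.
    + rewrite !inE mem_cat negb_or => /orP[xa|xb] /andP[xKa xKb].
        have [y yK nadj] := mKa x xa xKa; exists y; first by rewrite inE yK.
        have ya := sKa _ yK : y \in fvars a.
        by rewrite (negbTE nadj) (adjNl _ (dab _ xa)) (negbTE (dab _ xa)) (negbTE (dab _ ya)) andbF.
      have [y yK nadj] := mKb x xb xKb; exists y; first by rewrite inE yK orbT.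
      have yb := sKb _ yK : y \in fvars b.
      by rewrite (negbTE nadj) (adjNl _ (dba _ xb)) (negbTE (dba _ xb)) (negbTE (dba _ yb)) andbF.
  case/max_cliqueP: mK => sK cK mK.
  apply/andP; split; [apply/IHa; exists (K :&: [set v in fvars a])
    | apply/IHb; exists (K :&: [set v in fvars b])];
    rewrite ?(subset_trans (subsetIl _ _) KS) //; apply/max_cliqueP; split=> [x|x y|x].
  + by rewrite !inE => /andP[].
  + rewrite !inE => /andP[xK xa] /andP[yK ya] nxy; have := cK x y xK yK nxy.
    by rewrite /= (adjNl _ (dab _ xa)) (negbTE (dab _ xa)) (negbTE (dab _ ya)) andbF !orbF.
  + rewrite !inE => xa; rewrite xa andbT => xK.
    (* In the join [x] is adjacent to all of [b], so the member of [K] that blocks [x] lies in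
       [a]. *)
    have [|y yK] := mK x _ xK; first by rewrite inE mem_cat xa.
    rewrite /= xa !negb_or /= => /and4P[nadj _ yb _]; exists y => //.
    by have := sK y yK; rewrite !inE yK /= mem_cat (negbTE yb) orbF.
  + by rewrite !inE => /andP[].
  + rewrite !inE => /andP[xK xb] /andP[yK yb] nxy; have := cK x y xK yK nxy.
    by rewrite /= (adjNl _ (dba _ xb)) (negbTE (dba _ xb)) (negbTE (dba _ yb)) andbF !orbF.
  + rewrite !inE => xb; rewrite xb andbT => xK.
    have [|y yK] := mK x _ xK; first by rewrite inE mem_cat xb orbT.
    rewrite /= xb !negb_or /= => /and4P[_ nadj _ ya]; exists y => //.
    by have := sK y yK; rewrite !inE yK /= mem_cat (negbTE ya).
- have [/IHa{}IHa /IHb{}IHb dab dba] := uniq_catP Uab.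
  split=> /= [/orP[/IHa[K KS mK] | /IHb[K KS mK]] | [K KS mK]].
  (* The element [z] of [K] blocks every vertex of the other operand. *)
  + exists K => //; have [z zK] := max_clique_neq0 mK.
    case/max_cliqueP: mK => sK cK mK; apply/max_cliqueP; split=> [x /sK|x y xK yK nxy|x] /=.
    * by rewrite mem_cat => ->.
    * by rewrite cK.
    * rewrite mem_cat => /orP[xa|xb] xK.
        by have [y yK nadj] := mK x xa xK; exists y; rewrite // (adjNl _ (dab _ xa)) orbF.
      by exists z; rewrite // (adjNl _ (dba _ xb)) (adjNr _ (dab _ (sK _ zK))).
  + exists K => //; have [z zK] := max_clique_neq0 mK.
    case/max_cliqueP: mK => sK cK mK; apply/max_cliqueP; split=> [x /sK|x y xK yK nxy|x] /=.
    * by rewrite mem_cat => ->; rewrite orbT.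
    * by rewrite cK ?orbT.
    * rewrite mem_cat => /orP[xa|xb] xK.
        by exists z; rewrite // (adjNl _ (dab _ xa)) (adjNr _ (dba _ (sK _ zK))).
      by have [y yK nadj] := mK x xb xK; exists y; rewrite // (adjNl _ (dba _ xb)).
  + have [z zK] := @max_clique_neq0 (FOr a b) K mK; case/max_cliqueP: mK => sK cK mK.
    have := sK z zK; rewrite inE /= mem_cat => /orP[za|zb];
      apply/orP; [left; apply/IHa|right; apply/IHb];
      exists K => //; apply/max_cliqueP.
      (* No edge joins the two operands, so a clique containing [z] stays on the side of [z]. *)
      have Ka y : y \in K -> y \in fvars a.
        move=> yK; have [<-//|nzy] := eqVneq z y.
        by have := cK z y zK yK nzy; rewrite /= (adjNl _ (dab _ za)) orbF => /adj_vars[].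
      split=> [|x y xK yK nxy|x xa xK]; first exact: Ka.
        by have := cK x y xK yK nxy; rewrite /= (adjNl _ (dab _ (Ka _ xK))) orbF.
      have [|y yK /norP[nadj _]] := mK x _ xK; first by rewrite inE mem_cat (xa : x \in fvars a).
      by exists y.
    have Kb y : y \in K -> y \in fvars b.
      move=> yK; have [<-//|nzy] := eqVneq z y.
      by have := cK z y zK yK nzy; rewrite /= (adjNl _ (dba _ zb)) => /adj_vars[].
    split=> [|x y xK yK nxy|x xb xK]; first exact: Kb.
      by have := cK x y xK yK nxy; rewrite /= (adjNl _ (dba _ (Kb _ xK))).
    have [|y yK /norP[_ nadj]] := mK x _ xK; first by rewrite inE mem_cat (xb : x \in fvars b) orbT.
    by exists y.
Qed.

End Formulas.

(** * Query programs and their cost *)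

Section Programs.

Variable V : finType.

(* A query program in continuation-passing style. *)
Definition prog (T : Type) := (T -> learner V) -> learner V.

Definition bind T U (c : prog T) (d : T -> prog U) : prog U :=
  fun k => c (fun t => d t k).

Fixpoint foldp T I (body : I -> T -> prog T) (s : seq I) (t : T) : prog T :=
  if s is i :: s' then bind (body i t) (foldp body s') else fun k => k t.

Definition ask (S : {set V}) : prog bool :=
  Query [ffun v => if v \in S then Some true else None].

Variable oracle : passign V -> bool.

(** A Hoare triple with cost, for a fixed oracle: the value [t] handed over is the same for every
    continuation, which lets costs add up along [bind]. *)
Definition achieves N T (c : prog T) (P : T -> Prop) := exists2 t, P t &
  forall k, result (c k) oracle = result (k t) oracle /\
            nb_queries (c k) oracle <= N + nb_queries (k t) oracle.

Lemma achieves_ret N T (t : T) (P : T -> Prop) : P t -> achieves N (fun k => k t) P.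
Proof. by exists t => // k; rewrite leq_addl. Qed.

Lemma achieves_bind N M T U (c : prog T) (d : T -> prog U) P Q :
    achieves N c P -> (forall t, P t -> achieves M (d t) Q) ->
  achieves (N + M) (bind c d) Q.
Proof.
case=> t Pt ct dQ; have [u Qu du] := dQ t Pt; exists u => // k.
have [rc nc] := ct (fun t => d t k); have [rd nd] := du k.
rewrite /bind rc; split=> //; apply: leq_trans nc _.
by rewrite -addnA leq_add2l.
Qed.

(** The invariant is indexed by the list of items still to be processed. *)
Lemma achieves_fold N T I (body : I -> T -> prog T) (Inv : seq I -> T -> Prop) s t :
    (forall i s t, Inv (i :: s) t -> achieves N (body i t) (Inv s)) ->
  Inv s t -> achieves (size s * N) (foldp body s t) (Inv [::]).
Proof.
move=> step; elim: s t => [|i s IHs] t Inv_t; first exact: achieves_ret.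
by rewrite mulSn; apply: achieves_bind (step _ _ _ Inv_t) _ => u; apply: IHs.
Qed.

End Programs.

(** * The learning algorithm *)

Section Algorithm.

Variable V : finType.
Implicit Types (S Q P : {set V}) (x y v : V).

Definition minimize S : prog V {set V} :=
  foldp (fun v S => bind (ask (S :\ v)) (fun b k => k (if b then S :\ v else S)))
        (enum V) S.

Definition maximize Q : prog V {set V} :=
  foldp (fun v Q => bind (ask (v |: Q)) (fun b k => k (if b then Q else v |: Q)))
        (enum V) Q.

(* The first component collects critical pairs [(x, P)], i.e. [P] is false and
   [x |: P] is true; the second one maps the variables already treated to a
   maximal false point that avoids them. *)
Definition state : Type := {set V * {set V}} * {ffun V -> option {set V}}.

(** When no known variable is left untreated the step does nothing, so the number of rounds can be
    fixed in advance. *)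
Definition explore_step (s : state) : prog V state :=
  if [pick z in s.1 | s.2 z.1 == None] is Some z then
    bind (minimize (z.1 |: z.2)) (fun S =>
    bind (maximize z.2) (fun Q k =>
      k (s.1 :|: [set (y, S :\ y) | y in S] :|: [set (y, Q) | y in ~: Q],
         [ffun x => if x == z.1 then Some Q else s.2 x])))
  else fun k => k s.

(** The full set is a true point; minimizing it yields the first critical pairs. [#|V|] rounds
    suffice because a round that is not idle treats a new variable. *)
Definition explore : prog V {ffun V -> option {set V}} :=
  bind (minimize setT) (fun S =>
  bind (foldp (fun _ => explore_step) (enum V)
          ([set (y, S :\ y) | y in S], [ffun => None])) (fun s k => k s.2)).

(** The default [set0] only affects pairs with an untreated variable; [hypothesis] takes its
    vertices among the treated ones, so those answers do not influence it. *)
Definition edges (R : {ffun V -> option {set V}}) : prog V {set V * V} :=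
  foldp (fun z E => bind (ask ((z.1 |: odflt set0 (R z.1)) :&: (z.2 |: odflt set0 (R z.2))))
                     (fun b k => k (if b then z |: E else E :\ z)))
        (enum {: V * V}) set0.

(** The monotone DNF whose terms are the maximal cliques; building it asks no query. *)
Definition hypothesis (R : {ffun V -> option {set V}}) (E : {set V * V}) : boolfun V :=
  [ffun z : {ffun V -> bool} => [exists K : {set V}, (K \subset [set v | z v]) &&
     max_clique (fun x => R x != None) (fun x y => (x, y) \in E) K]].

Definition learn : learner V :=
  explore (fun R => edges R (fun E => Output (hypothesis R E))).

(** * Correctness and query count *)

Variables (f : boolfun V) (phi : formula V).
Hypotheses (Uphi : uniq (fvars phi)) (fE : forall z, f z = feval phi z).

Let oracle := subcube_identity f.
Let n := #|V|.

(** The greatest point of the subcube is the all-ones point, where [f] is true; the least one is [S]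
    itself. *)
Lemma query_sat S :
  oracle [ffun v => if v \in S then Some true else None] = sat phi S.
Proof.
set p := finfun _.
have ext_sat (y : {ffun free_var p -> bool}) : sat phi S -> f (extend y).
  rewrite fE feval_sat; apply: sat_sub; apply/subsetP=> v vS.
  by rewrite inE ffunE; case: insubP => [u|]; rewrite !ffunE vS.
have extT: f (@extend _ p [ffun=> true]).
  rewrite fE feval_sat; apply: sat_full => v _; rewrite inE ffunE.
  by case: insubP => [u|]; rewrite !ffunE //; case: ifP.
have ext0: f (@extend _ p [ffun=> false]) = sat phi S.
  rewrite fE feval_sat; congr sat; apply/setP=> v; rewrite inE ffunE.
  by case: insubP => [u|]; rewrite !ffunE; case: ifP.
apply/existsP/idP => [[b /forallP cb]|Sphi].
  have := cb [ffun=> true]; have := cb [ffun=> false].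
  by rewrite !ffunE extT ext0 => /eqP-> /eqP<-.
by exists true; apply/forallP=> y; rewrite ffunE ext_sat.
Qed.

Lemma ask_sat S : achieves oracle 1 (ask S) (eq (sat phi S)).
Proof. by exists (sat phi S) => // k; rewrite /= query_sat add1n. Qed.

Lemma minimize_spec S0 : sat phi S0 -> achieves oracle n (minimize S0) (fun S =>
  [/\ S \subset S0, sat phi S & {in S, forall v, ~~ sat phi (S :\ v)}]).
Proof.
move=> S0phi; rewrite /n cardE -[size _]muln1.
(* By monotonicity a deletion that was refused stays impossible while [S] shrinks, so one pass over
   the variables is enough. *)
pose Inv (s : seq V) S := [/\ S \subset S0, sat phi S
  & {in S, forall v, v \notin s -> ~~ sat phi (S :\ v)}].
have: Inv (enum V) S0 by split=> // v _; rewrite mem_enum.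
have step v s S : Inv (v :: s) S -> achieves oracle 1
    (bind (ask (S :\ v)) (fun b k => k (if b then S :\ v else S))) (Inv s).
  case=> sS tS mS; rewrite -[1]addn0; apply: achieves_bind (ask_sat _) _ => _ <-.
  apply: achieves_ret; case: ifP => [tSv|/negbT ntSv]; split=> //.
  - exact: subset_trans (subsetDl _ _) sS.
  - move=> w; rewrite 2!inE => /andP[wv wS] ws.
    have/mS := wS; rewrite inE negb_or wv => /(_ ws).
    by apply: contra; apply: sat_sub; rewrite setSD ?subsetDl.
  - move=> w wS ws; have [->//|wv] := eqVneq w v.
    by apply: mS; rewrite // inE negb_or wv.
move/(achieves_fold step) => [S [sS tS mS] cS]; exists S => //; split=> // v vS.
exact: mS.
Qed.

Lemma maximize_spec Q0 : ~~ sat phi Q0 -> achieves oracle n (maximize Q0) (fun Q =>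
  [/\ Q0 \subset Q, ~~ sat phi Q & forall v, v \notin Q -> sat phi (v |: Q)]).
Proof.
move=> Q0phi; rewrite /n cardE -[size _]muln1.
pose Inv (s : seq V) Q := [/\ Q0 \subset Q, ~~ sat phi Q
  & forall v, v \notin Q -> v \notin s -> sat phi (v |: Q)].
have: Inv (enum V) Q0 by split=> // v _; rewrite mem_enum.
have step v s Q : Inv (v :: s) Q -> achieves oracle 1
    (bind (ask (v |: Q)) (fun b k => k (if b then Q else v |: Q))) (Inv s).
  case=> sQ tQ mQ; rewrite -[1]addn0; apply: achieves_bind (ask_sat _) _ => _ <-.
  apply: achieves_ret; case: ifP => [tQv|/negbT ntQv]; split=> //.
  - move=> w wQ ws; have [->//|wv] := eqVneq w v.
    by apply: mQ; rewrite // inE negb_or wv.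
  - exact: subset_trans sQ (subsetUr _ _).
  - move=> w; rewrite !inE negb_or => /andP[wv wQ] ws.
    have := mQ w wQ; rewrite inE negb_or wv => /(_ ws).
    by apply: sat_sub; rewrite setUS ?subsetUr.
move/(achieves_fold step) => [Q [sQ tQ mQ] cQ]; exists Q => //; split=> // v vQ.
exact: mQ.
Qed.

Definition known (s : state) : {set V} := [set z.1 | z in s.1].

Definition treated (R : {ffun V -> option {set V}}) : {set V} := [set x | R x != None].

(** The first clause provides the starting variable for [explored_all]; the last one provides its
    other hypothesis once all known variables are treated. *)
Definition sound (s : state) :=
  [/\ s.1 != set0,
      forall x P, (x, P) \in s.1 -> ~~ sat phi P /\ sat phi (x |: P)
    & forall x Q, s.2 x = Some Q ->
        [/\ maxfalse phi Q, x \notin Q & x \in fvars phi] /\ explored phi (known s) x].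

Lemma known_vars s x : sound s -> x \in known s -> x \in fvars phi.
Proof. by case=> _ crit _ /imsetP[[y P] /crit[nP yP] ->]; apply: critical_var nP yP. Qed.

Lemma explored_sub (U U' : {set V}) x : U \subset U' -> explored phi U x -> explored phi U' x.
Proof.
move/subsetP=> sU [[S mS [xS SU]] [Q mQ [xQ QU]]].
split; [exists S | exists Q] => //; split=> // v vphi ?; apply: sU; first exact: SU.
exact: QU.
Qed.

(** The disjunction reads: the [m] remaining rounds can treat all untreated variables, or the
    exploration is already saturated. *)
Lemma explore_step_spec m s :
    sound s /\ (#|~: treated s.2| <= m.+1 \/ known s \subset treated s.2) ->
  achieves oracle (n + n) (explore_step s)
    (fun s => sound s /\ (#|~: treated s.2| <= m \/ known s \subset treated s.2)).
Proof.
case=> snd prog_s; rewrite /explore_step; case: pickP => [[x P] /=|done]; last first.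
  apply: achieves_ret; split=> //; right; apply/subsetP=> _ /imsetP[z zD ->].
  by rewrite inE; have:= done z; rewrite zD => /negbT.
case/andP=> xPD Rx; have [D0 crit res] := snd; have [nP xP] := crit x P xPD.
have xphi := critical_var nP xP.
apply: achieves_bind (minimize_spec xP) _ => S [sS tS mS].
rewrite -[n in achieves _ n]addn0.
apply: achieves_bind (maximize_spec nP) _ => Q [sQ nQ mQ].
apply: achieves_ret.
(* Without [x], the true point [S] would lie below the false point [P]. *)
have xS: x \in S.
  apply: contraNT nP => xS; apply: sat_sub tS; apply/subsetP=> v vS.
  by have := subsetP sS v vS; rewrite !inE; case: eqP vS xS => // -> ->.
(* With [x], the false point [Q] would lie above the true point [x |: P]. *)
have xQ: x \notin Q.
  apply: contraNN nQ => xQ; apply: sat_sub xP.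
  by rewrite subUset sub1set xQ.
set s' := (_, _).
have sub_known: known s \subset known s'.
  apply/subsetP=> _ /imsetP[z zD ->]; apply/imsetP; exists z => //.
  by rewrite !inE zD.
have Sknown: S \subset known s'.
  apply/subsetP=> v vS; apply/imsetP; exists (v, S :\ v) => //.
  rewrite !inE; apply/orP; left; apply/orP; right; apply/imsetP; by exists v.
have Qknown v : v \notin Q -> v \in known s'.
  move=> vQ; apply/imsetP; exists (v, Q) => //.
  by rewrite !inE; apply/orP; right; apply/imsetP; exists v; rewrite ?inE.
split.
  split=> [|y P'|y Q' /=].
  - by apply/set0Pn; exists (x, P); rewrite !inE xPD.
  - rewrite !inE => /orP[/orP[/crit//|/imsetP[v vS [-> ->]]]|/imsetP[v]].
      by split; [apply: mS | rewrite setD1K].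
    by rewrite inE => vQ [-> ->]; split=> //; apply: mQ.
  - rewrite ffunE; case: eqP => [-> [<-]|_ /res[? ey]]; last first.
      by split=> //; apply: explored_sub ey.
    split; first by split=> //; split=> // v _; apply: mQ.
    split; [exists S | exists Q].
    + by split=> // v _; apply: mS.
    + by split=> // v _; apply: (subsetP Sknown).
    + by split=> // v _; apply: mQ.
    + by split=> // v _; apply: Qknown.
(* [x] was known but untreated, so the state was not saturated, and treating [x] pays for this
   round. *)
left; case: prog_s => [le_m|/subsetP sub]; last first.
  suff: x \in treated s.2 by rewrite inE Rx.
  by apply: sub; apply/imsetP; exists (x, P).
rewrite -ltnS; apply: leq_trans le_m; apply: proper_card; apply/properP; split.
  by apply/subsetP=> v; rewrite !inE /= ffunE; case: (v == x).
by exists x; rewrite !inE /= ?ffunE ?eqxx // Rx.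
Qed.

Lemma explore_spec : achieves oracle (n + n * (n + n)) explore (fun R =>
  (forall x, (R x != None) = (x \in fvars phi)) /\
  (forall x Q, R x = Some Q -> maxfalse phi Q /\ x \notin Q)).
Proof.
have TS : sat phi setT by apply: sat_full => v _; rewrite inE.
apply: achieves_bind (minimize_spec TS) _ => S [_ tS mS].
rewrite -[n * _]addn0 {1}/n cardE.
pose Inv (r : seq V) (s : state) :=
  sound s /\ (#|~: treated s.2| <= size r \/ known s \subset treated s.2).
have init: Inv (enum V) ([set (y, S :\ y) | y in S], [ffun => None]).
  split; last by left; rewrite -cardE max_card.
  split=> [|x P /imsetP[v vS [-> ->]]|x Q] /=.
  - have [v _ vS] := sat_meets tS.
    by apply/set0Pn; exists (v, S :\ v); apply/imsetP; exists v.
  - by rewrite setD1K // mS.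
  - by rewrite ffunE.
have step (v : V) r s : Inv (v :: r) s -> achieves oracle (n + n) (explore_step s) (Inv r).
  exact: explore_step_spec.
apply: achieves_bind (achieves_fold step init) _ => s [snd fin].
apply: achieves_ret; have [D0 crit res] := snd.
(* With no round left, either every variable is treated or saturation came first. *)
have known_treated: known s \subset treated s.2.
  case: fin => //; rewrite leqn0 cards_eq0 => /eqP t0.
  by rewrite -[treated _]setCK t0 setC0 subsetT.
split=> [x|x Q /res[[mQ xQ _] _]//].
apply/idP/idP => [|xphi].
  by case Rx: (s.2 x) => [Q|] // _; have [[]] := res x Q Rx.
suff: x \in treated s.2 by rewrite inE.
apply: (subsetP known_treated); apply: explored_all xphi => //.
  have/set0Pn[z zD] := D0; exists z.1; last by apply/imsetP; exists z.
  by apply: (known_vars snd); apply/imsetP; exists z.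
move=> y yphi /(subsetP known_treated); rewrite inE.
by case Ry: (s.2 y) => [Q|] // _; have [] := res y Q Ry.
Qed.

Lemma edges_spec (R : {ffun V -> option {set V}}) :
    (forall x, (R x != None) = (x \in fvars phi)) ->
    (forall x Q, R x = Some Q -> maxfalse phi Q /\ x \notin Q) ->
  achieves oracle (n * n) (edges R) (fun E =>
    {in fvars phi &, forall x y, x != y -> ((x, y) \in E) = adj phi x y}).
Proof.
move=> domR mR; rewrite -[_ * _]muln1 /n -card_prod cardE.
pose Inv (r : seq (V * V)) (E : {set V * V}) := {in fvars phi &, forall x y,
  x != y -> (x, y) \notin r -> ((x, y) \in E) = adj phi x y}.
have init: Inv (enum {: V * V}) set0 by move=> x y _ _ _; rewrite mem_enum.
have step z r (E : {set V * V}) : Inv (z :: r) E -> achieves oracle 1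
   (bind (ask ((z.1 |: odflt set0 (R z.1)) :&: (z.2 |: odflt set0 (R z.2))))
      (fun b k => k (if b then z |: E else E :\ z))) (Inv r).
  move=> invE; rewrite -[1]addn0; apply: achieves_bind (ask_sat _) _ => _ <-.
  apply: achieves_ret => x y xphi yphi nxy xyr.
  have [<-|nz] := eqVneq (x, y) z; last first.
    have := invE x y xphi yphi nxy; rewrite inE negb_or nz => /(_ xyr) <-.
    by case: ifP; rewrite !inE (negbTE nz).
  have: R x != None by rewrite domR.
  have: R y != None by rewrite domR.
  case Ry: (R y) => [Q'|] // _; case Rx: (R x) => [Q|] // _ /=; rewrite ?Rx ?Ry /=.
  have [mQ xQ] := mR _ _ Rx; have [mQ' yQ'] := mR _ _ Ry.
  by rewrite -adj_test //; case: adj; rewrite !inE eqxx.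
have [E invE cE] := achieves_fold step init.
by exists E => // x y xphi yphi nxy; apply: invE.
Qed.

Lemma hypothesis_correct (R : {ffun V -> option {set V}}) (E : {set V * V}) :
    (forall x, (R x != None) = (x \in fvars phi)) ->
    {in fvars phi &, forall x y, x != y -> ((x, y) \in E) = adj phi x y} ->
  hypothesis R E = f.
Proof.
move=> domR adjE; apply/ffunP=> z; rewrite fE feval_sat ffunE.
(* The two relations agree on distinct variables of [phi]; a vertex outside [K] differs from every
   member of [K], so its comparisons are of this kind too. *)
have eqK K : max_clique (fun x => R x != None) (fun x y => (x, y) \in E) K =
             max_clique (mem (fvars phi)) (adj phi) K.
  apply/max_cliqueP/max_cliqueP=> [] [sK cK mK].
    have {}sK x : x \in K -> x \in fvars phi by move/sK; rewrite domR.
    split=> // [x y xK yK nxy|x xphi xK].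
      by rewrite -adjE ?sK // cK.
    have [|y yK nE] := mK x _ xK; first by rewrite domR.
    exists y => //; rewrite -adjE ?(sK y) //.
    by apply: contraNneq xK => ->.
  have {}sK x : x \in K -> x \in fvars phi by move/sK.
  split=> // [x /sK|x y xK yK nxy|x xphi xK].
  - by rewrite domR.
  - by rewrite adjE ?sK // cK.
  rewrite domR in xphi; have [y yK nE] := mK x xphi xK.
  exists y => //; rewrite adjE ?(sK y) //.
  by apply: contraNneq xK => ->.
apply/existsP/idP => [[K /andP[KS]]|].
  by rewrite eqK => mK; apply/(sat_max_clique _ Uphi); exists K.
by case/(sat_max_clique _ Uphi) => K KS mK; exists K; rewrite KS eqK.
Qed.

(** Exploration costs at most [n + 2 * n ^ 2] queries and the pairwise tests [n ^ 2]; the constant 4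
    absorbs the linear term through [n <= n ^ 2]. *)
Lemma learn_spec : result learn oracle = f /\
  nb_queries learn oracle <= 4 * n ^ 2.
Proof.
have [R [domR mR] cR] := explore_spec.
have [E adjE cE] := edges_spec domR mR.
have [rR nR] := cR (fun R => edges R (fun E => Output (hypothesis R E))).
have [rE nE] := cE (fun E => Output (hypothesis R E)).
split; first by rewrite /learn rR rE /= hypothesis_correct.
apply: leq_trans nR _; apply: leq_trans (leq_add (leqnn _) nE) _.
rewrite /= addn0 -mulnn mulnDr !mulSn mul0n addn0 -!addnA leq_add2r.
by case: (n) => // m; rewrite leq_pmull.
Qed.

End Algorithm.

Theorem theorem1 :
  exists (A : forall n : nat, learner 'I_n) (C : nat),
    forall (n : nat) (f : boolfun 'I_n),
      ~~ constant_fun f -> read_once f ->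
      result (A n) (subcube_identity f) = f /\
      nb_queries (A n) (subcube_identity f) <= C * n ^ 2.
Proof.
exists (fun n => learn 'I_n), 4 => n f _ [phi Uphi fE].
by have := learn_spec Uphi fE; rewrite card_ord.
Qed.
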